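(* For every positive integer $r$ and every $z\in[0,1]$, \[ \sum_{n=1}^\infty \frac{\binom{2n}{n}}{n4^n}\zeta_n^\star(\{2\}_r)(1-z)^n=-2\,\mathrm{Li}_{2r+1}\left(\frac{\sqrt z-1}{\sqrt z+1}\right). \]
   Context: For a positive integer $n$ and a tuple $(k_1,\ldots,k_r)$ of positive integers, $\zeta^\star_n(k_1,\ldots,k_r):=\sum_{n\ge n_1\ge\cdots\ge n_r>0}\frac{1}{n_1^{k_1}\cdots n_r^{k_r}}$; $\{2\}_r$ denotes $2,\ldots,2$ with $r$ repetitions. The polylogarithm is $\mathrm{Li}_p(x):=\sum_{n=1}^\infty \frac{x^n}{n^p}$ for $x\in[-1,1]$, $p$ a positive integer, $(p,x)\ne(1,1)$. *)

(* Defs.v *)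
From HB Require Import structures.
From mathcomp Require Import all_boot all_order all_algebra.
From mathcomp Require Import all_classical all_reals all_analysis.

Set Implicit Arguments.
Unset Strict Implicit.
Unset Printing Implicit Defensive.

Import Order.TTheory GRing.Theory Num.Theory.
Import numFieldNormedType.Exports.

Local Open Scope classical_set_scope.
Local Open Scope ring_scope.

(* The summation range n >= n_1 >= ... >= n_r > 0: the bound by n is carried
   by the type 'I_n.+1 of the entries of m. *)
Definition zeta_star (R : realType) (r : nat) (k : r.-tuple nat) (n : nat) : R :=
  \sum_(m : r.-tuple 'I_n.+1 |
        sorted geq [seq nat_of_ord i | i <- m] && all (fun i : 'I_n.+1 => (0 < i)%N) m)
    (\prod_(i < r) (tnth m i)%:R ^+ tnth k i)^-1.

(* {2}_r *)
Definition twos (r : nat) : r.-tuple nat := [tuple of nseq r 2%N].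

(* Meaningful where the series converges: x in [-1, 1], p > 0 and
   (p, x) != (1, 1). *)
Definition Li (R : realType) (p : nat) (x : R) : R :=
  limn (fun N : nat => \sum_(1 <= n < N) x ^+ n / n%:R ^+ p : R).

(* Main.v *)
Require Import Defs.
From HB Require Import structures.
From mathcomp Require Import all_boot all_order all_algebra.
From mathcomp Require Import all_classical all_reals all_analysis.
From mathcomp Require Import ring lra zify.

Set Implicit Arguments.
Unset Strict Implicit.
Unset Printing Implicit Defensive.

Import Order.TTheory GRing.Theory Num.Theory.
Import numFieldNormedType.Exports.

Local Open Scope classical_set_scope.
Local Open Scope ring_scope.

(* Write w(n,k) = C(2n,n+k) / C(2n,n). Since w(n,k) - w(n-1,k) = (k/n)^2 w(n,k),
   the recursion of the star sum in r gives
     zeta*_n({2}_r) = -2 sum_(1 <= k <= n) (-1)^k w(n,k) / k^(2r),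
   the case r = 0 being the vanishing of an alternating sum of binomials. With
   the ballot numbers b(n,k) = (k/n) C(2n,n+k) the left-hand side becomes
     -2 sum_k (-1)^k / k^(2r+1) sum_n b(n,k) y^n,   y = (1 - z) / 4.
   For t = (1 - sqrt z) / (1 + sqrt z) one has y = t / (1 + t)^2, and the inner
   sum is t^k: its partial sums are bounded by t^k by the recursion
   b(n+1,k) = b(n,k-1) + 2 b(n,k) + b(n,k+1), and the difference between t^k and
   the limit is a bounded convex sequence in k vanishing at k = 0. The exchange
   of summations is Tannery's theorem with majorant 1/k^2, valid up to t = 1. *)

(** * Ballot numbers *)

(** The recursion avoids the division in (k/n) C(2n, n+k) and fixes the row n = 0, where that
    formula has no meaning. *)
Fixpoint ballot (n k : nat) : nat :=
  match n, k with
  | 0, _ => (k == 0)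
  | n'.+1, 0 => 0
  | n'.+1, k'.+1 => (ballot n' k' + 2 * ballot n' k'.+1 + ballot n' k'.+2)%N
  end.
Arguments ballot : simpl never.

Lemma ballotSS (n k : nat) :
  ballot n.+1 k.+1 = (ballot n k + 2 * ballot n k.+1 + ballot n k.+2)%N.
Proof. by []. Qed.

(** Pascal's rule applied twice gives the binomial difference the recursion of [ballot]; at k = 0
    the two binomials agree by symmetry. The additive form avoids truncated subtraction. *)
Lemma ballot_add_bin (n k : nat) :
  (ballot n.+1 k + 'C((2 * n).+1, (n + k).+1) = 'C((2 * n).+1, n + k))%N.
Proof.
elim: n k => [|n IHn] [|k].
- by [].
- by case: k => [|k].
- rewrite add0n addn0 -[in LHS](bin_sub (m := n.+2)); last lia.
  by congr ('C(_, _)); lia.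
- rewrite ballotSS.
  have -> : ((2 * n.+1).+1 = (2 * n).+3)%N by lia.
  have -> : ((n.+1 + k.+1).+1 = (n + k).+3)%N by lia.
  have -> : ((n.+1 + k.+1) = (n + k).+2)%N by lia.
  rewrite !(binS (2 * n).+2) !(binS (2 * n).+1).
  move: (IHn k) (IHn k.+1) (IHn k.+2).
  by rewrite !addnS; lia.
Qed.

Lemma ballotE (n k : nat) :
  (n.+1 * ballot n.+1 k = k * 'C(2 * n.+1, n.+1 + k))%N.
Proof.
have h := ballot_add_bin n k.
have -> : (2 * n.+1 = (2 * n).+2)%N by lia.
have hd := mul_bin_diag (2 * n).+2 (n + k).
have hl := mul_bin_left (2 * n).+1 (n + k).
rewrite addSn; rewrite /= in hd; move: h hd hl.
set a := ballot _ _; set b := 'C(_, (n + k).+1); set c := 'C(_, n + k).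
set d := 'C(_, _) => h hd hl.
have [hk|hk] := leqP (n + k) (2 * n).+1; last first.
  have hb0 : c = 0%N by rewrite /c bin_small.
  have hd0 : d = 0%N by rewrite /d bin_small //; lia.
  have -> : a = 0%N by lia.
  by rewrite hd0 !muln0.
(* After multiplication by n+k+1, [hd] and [hl] express [d] and [b] through [c]; [hk] makes the
   subtraction in [hl] exact. *)
apply/eqP; rewrite -(eqn_pmul2l (ltn0Sn (n + k))); apply/eqP.
nia.
Qed.

(** * Ratios of binomial coefficients and their alternating sums *)

Section RatioOfBinomials.
Variable R : realType.
Implicit Types n k : nat.

(** This is w(n,k) in product form; the subtraction is taken in [R], and the factor j = n makes it
    vanish for k > n. *)
Definition bin_ratio n k : R := \prod_(0 <= j < k) ((n%:R - j%:R) / (n + j).+1%:R).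

Lemma bin_ratio0 n : bin_ratio n 0 = 1.
Proof. by rewrite /bin_ratio big_geq. Qed.

Lemma bin_ratioS n k :
  bin_ratio n k.+1 = bin_ratio n k * ((n%:R - k%:R) / (n + k).+1%:R).
Proof. by rewrite /bin_ratio big_nat_recr. Qed.

Lemma bin_ratio_small n k : (n < k)%N -> bin_ratio n k = 0.
Proof.
elim: k => // k IHk; rewrite ltnS leq_eqVlt bin_ratioS => /predU1P[->|/IHk ->].
  by rewrite subrr mul0r mulr0.
by rewrite mul0r.
Qed.

Lemma bin_mul_ratio n k : 'C(2 * n, n)%:R * bin_ratio n k = 'C(2 * n, n + k)%:R.
Proof.
elim: k => [|k IHk]; first by rewrite bin_ratio0 mulr1 addn0.
rewrite bin_ratioS mulrA IHk mulrA.
have h0 : (n + k).+1%:R != 0 :> R by rewrite pnatr_eq0.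
apply: (mulIf h0); rewrite divfK //.
have [hk|hk] := leqP k n; last first.
  by rewrite !bin_small ?mul0r //; lia.
rewrite -natrB // -!natrM; congr (_%:R).
rewrite mulnC [RHS]mulnC addnS mul_bin_left; congr (_ * _)%N; lia.
Qed.

(** The relation w(n,k) - w(n-1,k) = (k/n)^2 w(n,k), cleared of denominators and shifted to n+1. *)
Lemma bin_ratio_shift n k :
  (n.+1%:R ^+ 2 - k%:R ^+ 2) * bin_ratio n.+1 k = n.+1%:R ^+ 2 * bin_ratio n k.
Proof.
elim: k => [|k IHk]; first by rewrite !bin_ratio0 expr0n /= subr0.
rewrite !bin_ratioS mulrA [in RHS]mulrA -IHk.
have h1 : (n.+1 + k).+1%:R != 0 :> R by rewrite pnatr_eq0.
have h2 : (n + k).+1%:R != 0 :> R by rewrite pnatr_eq0.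
move: h1 h2; rewrite !addSn -!natr1 natrD => h1 h2.
by field; rewrite h1 h2.
Qed.

(** The alternating sum telescopes; the factor n+1-k of the remainder vanishes at k = n+1. *)
Lemma alternating_bin_ratio_partial n k :
  2 * \sum_(1 <= j < k.+1) (-1) ^+ j * bin_ratio n.+1 j =
  -1 + (-1) ^+ k * bin_ratio n.+1 k * ((n.+1%:R - k%:R) / n.+1%:R).
Proof.
have h0 : n.+1%:R != 0 :> R by rewrite pnatr_eq0.
elim: k => [|k IHk].
  by rewrite big_geq // bin_ratio0 expr0 subr0 divff // !mulr1 mulr0 addNr.
rewrite big_nat_recr //= mulrDr IHk bin_ratioS exprS.
have h1 : (n.+1 + k).+1%:R != 0 :> R by rewrite pnatr_eq0.
move: h0 h1; rewrite !addSn -!natr1 natrD => h0 h1.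
by field; rewrite h1 h0.
Qed.

Lemma alternating_bin_ratio n : (0 < n)%N ->
  - 2 * \sum_(1 <= k < n.+1) (-1) ^+ k * bin_ratio n k = 1.
Proof.
case: n => // n _; rewrite mulNr alternating_bin_ratio_partial.
by rewrite subrr mul0r mulr0 addr0 opprK.
Qed.

Definition alt_sum r n : R :=
  - 2 * \sum_(1 <= k < n.+1) (-1) ^+ k * bin_ratio n k / k%:R ^+ (2 * r).

Lemma alt_sum_widen r n N : (n < N)%N ->
  alt_sum r n = - 2 * \sum_(1 <= k < N) (-1) ^+ k * bin_ratio n k / k%:R ^+ (2 * r).
Proof.
move=> hN; rewrite /alt_sum; congr (_ * _).
rewrite (@big_cat_nat _ _ _ n.+1 1 N) //=.
rewrite [X in _ = _ + X]big_nat [X in _ = _ + X]big1 ?addr0 // => k /andP[hk _].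
by rewrite bin_ratio_small // mulr0 mul0r.
Qed.

Lemma alt_sum0 n : (0 < n)%N -> alt_sum 0 n = 1.
Proof.
move=> hn; rewrite -(alternating_bin_ratio hn); congr (_ * _).
by apply: eq_bigr => k _; rewrite muln0 expr0 divr1.
Qed.

(** Induction on n: the difference w(n+1,k) - w(n,k) supplies a factor k^2/(n+1)^2, which lowers
    k^(2r+2) to k^(2r). Widening gives both sums the same range of k. *)
Lemma alt_sumS r n : alt_sum r.+1 n = \sum_(1 <= m < n.+1) alt_sum r m / m%:R ^+ 2.
Proof.
elim: n => [|n IHn]; first by rewrite /alt_sum !big_geq // mulr0.
rewrite big_nat_recr //= -IHn (@alt_sum_widen r.+1 n n.+2) //.
apply/eqP; rewrite -subr_eq0; apply/eqP.
rewrite /alt_sum !(mulr_sumr, mulr_suml) -big_split /= -sumrB.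
rewrite big_nat big1 // => k /andP[hk _].
have hk0 : k%:R != 0 :> R by rewrite pnatr_eq0 -lt0n.
have hn0 : n.+1%:R != 0 :> R by rewrite pnatr_eq0.
have -> : bin_ratio n k = (n.+1%:R ^+ 2 - k%:R ^+ 2) * bin_ratio n.+1 k / n.+1%:R ^+ 2.
  by rewrite bin_ratio_shift mulrC mulKf // expf_neq0.
rewrite mulnS exprD.
have hkr : k%:R ^+ (2 * r) != 0 :> R by rewrite expf_neq0.
by move: hkr hn0; rewrite -natr1; set x := k%:R ^+ (2 * r); move=> hx hn0; field; rewrite hk0 hx hn0.
Qed.

End RatioOfBinomials.

(** * Recursion of the star sums *)

Section ZetaStar.
Variable R : realType.

(* The bound on n_1 is decoupled from the type of the entries, so that peeling
   off n_1 leaves a sum over tuples of the same type. *)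
Definition bounded_zeta_star (N r n : nat) : R :=
  \sum_(m : r.-tuple 'I_N.+1 |
        path geq n [seq nat_of_ord i | i <- m] && all (fun i : 'I_N.+1 => (0 < i)%N) m)
    (\prod_(i < r) (tnth m i)%:R ^+ 2)^-1.

Lemma bounded_zeta_star0 N n : bounded_zeta_star N 0 n = 1.
Proof.
rewrite /bounded_zeta_star (big_pred1 [tuple]) => [|m].
  by rewrite big_ord0 invr1.
by rewrite tuple0 /= eqxx.
Qed.

(** Tuples are reindexed by head and tail; the head m = n_1 becomes the bound for the tail. *)
Lemma bounded_zeta_starS N r n : (n <= N)%N ->
  bounded_zeta_star N r.+1 n =
  \sum_(1 <= m < n.+1) bounded_zeta_star N r m / m%:R ^+ 2.
Proof.
move=> hn; rewrite /bounded_zeta_star.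
rewrite (reindex (fun p : 'I_N.+1 * r.-tuple 'I_N.+1 => [tuple of p.1 :: p.2])) /=; last first.
  exists (fun t => (thead t, [tuple of behead t])) => [[x t] _|t _] /=.
    by rewrite theadE; congr pair; apply: val_inj.
  by rewrite -tuple_eta.
transitivity (\sum_(i < N.+1 | (0 < i <= n)%N) bounded_zeta_star N r i / i%:R ^+ 2).
  rewrite /bounded_zeta_star; under [RHS]eq_bigr do rewrite mulr_suml.
  rewrite pair_big_dep /=; apply: eq_big => [[i t]|[i t] _] /=.
    by rewrite -!andbA; do !bool_congr.
  rewrite big_ord_recl tnth0 mulrC invfM; congr (_ * _).
  by congr (_ ^-1); apply: eq_bigr => j _; rewrite tnthS.
rewrite -(big_mkord (fun i => (0 < i <= n)%N)
   (fun i => bounded_zeta_star N r i / i%:R ^+ 2)).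
rewrite big_mkcond /= big_ltn //= add0r (@big_cat_nat _ _ _ n.+1) //=.
rewrite [X in _ + X = _]big_nat [X in _ + X = _]big1; last first.
  by move=> i /andP[hi _]; rewrite [(i <= n)%N]leqNgt hi andbF.
rewrite addr0.
by apply: eq_big_nat => i /andP [h0 h1]; rewrite h0 -ltnS h1.
Qed.

(** For N = n, the condition that [path] adds on the head holds by the type of the entries. *)
Lemma zeta_star_twosE r n : zeta_star R (twos r) n = bounded_zeta_star n r n.
Proof.
apply: eq_big => [m|m _].
  congr (_ && _); case: m => -[|i s] //= _.
  by rewrite -ltnS ltn_ord.
by congr (_ ^-1); apply: eq_bigr => i _; rewrite /twos tnth_nseq.
Qed.
End ZetaStar.

(** * Tannery's theorem and its majorant *)

Lemma cvg_sum_nat (R : realType) (K : nat) (d : nat -> nat -> R) (l : nat -> R) :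
  (forall k, d ^~ k @ \oo --> l k) ->
  (fun N => \sum_(0 <= k < K) d N k) @ \oo --> \sum_(0 <= k < K) l k.
Proof.
move=> hd; elim: K => [|K IHK].
  by under eq_fun do rewrite big_geq //; rewrite big_geq //; exact: cvg_cst.
under eq_fun do rewrite big_nat_recr //=.
by rewrite big_nat_recr //=; apply: cvgD.
Qed.

(** Diagonal form: N is both the parameter and the cut-off. The sum of u - v is split at a fixed K:
    the head is a finite sum tending to 0, the tail is at most twice a tail of [M]. *)
Lemma tannery (R : realType) (u : nat -> nat -> R) (v M : nat -> R) :
  (forall N k, `|u N k| <= M k) -> cvgn (series M) ->
  (forall k, u ^~ k @ \oo --> v k) ->
  (fun N => \sum_(0 <= k < N) u N k) @ \oo --> limn (series v).
Proof.
move=> uM cM uv.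
have vM k : `|v k| <= M k.
  have : (fun N => `|u N k|) @ \oo --> `|v k| by apply: cvg_norm; exact: uv.
  move=> h; rewrite -(cvg_lim (@Rhausdorff R) h); apply: limr_le.
    by apply/cvg_ex; exists `|v k|.
  by near=> N; exact: uM.
have M0 k : 0 <= M k by exact: le_trans (vM k).
have cv : cvgn (series v).
  by apply: normed_cvg; apply: (series_le_cvg _ M0 vM cM) => k; exact: normr_ge0.
have ndM : {homo series M : n m / (n <= m)%N >-> n <= m}.
  exact: (@nondecreasing_series _ M xpredT 0 (fun k _ _ => M0 k)).
suff h0 : (fun N => \sum_(0 <= k < N) u N k - series v N) @ \oo --> (0 : R).
  have -> : (fun N => \sum_(0 <= k < N) u N k) =
    (fun N => \sum_(0 <= k < N) u N k - series v N + series v N).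
    by apply/funext => N; rewrite subrK.
  by rewrite -[X in _ --> X]add0r; exact: cvgD.
apply/cvgrPdist_le => e e0.
(* The tail of [M] enters with a factor 2 and may use only half of [e]. *)
have e4 : 0 < e / 4 by rewrite divr_gt0.
have /cvgrPdist_le/(_ _ e4)[K _ hK] := cM.
have hsum : (fun N => \sum_(0 <= k < K) (u N k - v k)) @ \oo --> (0 : R).
  have := @cvg_sum_nat R K (fun N k => u N k - v k) (fun=> 0).
  rewrite big1 //; apply => k.
  by rewrite -(subrr (v k)); apply: cvgB; [exact: uv | exact: cvg_cst].
have e2 : 0 < e / 2 by rewrite divr_gt0.
have /cvgrPdist_le/(_ _ e2) hs := hsum.
near=> N.
have KN : (K <= N)%N by near: N; exact: nbhs_infty_ge.
rewrite sub0r normrN /series /= -sumrB (@big_cat_nat _ _ _ K) //=.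
apply: (le_trans (ler_normD _ _)).
rewrite [leRHS]splitr lerD //.
  by rewrite -normrN -sub0r; near: N; exact: hs.
apply: (le_trans (ler_norm_sum _ _ _)).
apply: (@le_trans _ _ (\sum_(K <= k < N) (2 * M k))).
  apply: ler_sum => k _; apply: (le_trans (ler_normB _ _)).
  by rewrite mulr_natl mulr2n lerD.
rewrite -mulr_sumr.
have -> : \sum_(K <= k < N) M k = series M N - series M K.
  by rewrite /series /= (@big_cat_nat _ _ _ K 0 N) //= addrAC subrr add0r.
have h1 : series M N <= limn (series M) by exact: nondecreasing_cvgn_le.
have := hK K (leqnn K); rewrite /= ger0_norm; first by lra.
by rewrite subr_ge0; exact: nondecreasing_cvgn_le.
Unshelve. all: by end_near.
Qed.

Lemma cvg_series_inv_sqr (R : realType) :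
  cvgn (series (fun n => (n%:R ^+ 2)^-1 : R)).
Proof.
apply: nondecreasing_is_cvgn.
  by apply: nondecreasing_series => n _ _; rewrite invr_ge0 exprn_ge0.
exists 2 => _ [n _ <-]; rewrite /series /=.
(* Telescoping bound from 1/(x+1)^2 <= 1/x - 1/(x+1); the term k = 0 is 0 because the inverse of 0
   is 0. *)
suff H m : \sum_(0 <= k < m.+2) (k%:R ^+ 2)^-1 <= 2 - m.+1%:R^-1 :> R.
  case: n => [|[|n]].
  - by rewrite big_geq.
  - by rewrite big_nat1 expr0n /= invr0.
  - by apply: (le_trans (H n)); rewrite gerBl invr_ge0.
elim: m => [|m IHm].
  rewrite big_nat_recr //= big_nat1 expr0n /= invr0 expr1n invr1; lra.
rewrite big_nat_recr //=; apply: (le_trans (lerD IHm (lexx _))).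
have h : 0 < m.+1%:R :> R by rewrite ltr0n.
rewrite -(@natr1 _ m.+1); move: m.+1%:R h => x h.
have hx : x != 0 by rewrite gt_eqF.
have hx1 : x + 1 != 0 by rewrite gt_eqF //; lra.
rewrite -subr_ge0.
have -> : 2 - (x + 1)^-1 - (2 - x^-1 + ((x + 1) ^+ 2)^-1) = (x * (x + 1) ^+ 2)^-1.
  by field; rewrite hx hx1.
by rewrite invr_ge0 mulr_ge0 ?exprn_ge0 //; lra.
Qed.

(** * Generating functions of the ballot numbers *)

Section BallotSeries.
Variable R : realType.
Implicit Types (y t : R) (n k N : nat).

Definition ballot_psum y N k : R := \sum_(0 <= n < N) (ballot n k)%:R * y ^+ n.

Lemma ballot_psum0 y N : ballot_psum y N.+1 0 = 1.
Proof.
rewrite /ballot_psum big_nat_recl //= mul1r big1 ?addr0 // => n _.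
by rewrite mul0r.
Qed.

Lemma ballot_psumSS y N k :
  ballot_psum y N.+1 k.+1 =
  y * (ballot_psum y N k + 2 * ballot_psum y N k.+1 + ballot_psum y N k.+2).
Proof.
rewrite /ballot_psum big_nat_recl // mul0r add0r.
rewrite [2 * _]mulr_sumr -!big_split /= mulr_sumr; apply: eq_bigr => n _.
by rewrite ballotSS natrD natrD natrM exprS; ring.
Qed.

Lemma ballot_psum_ge0 y N k : 0 <= y -> 0 <= ballot_psum y N k.
Proof. by move=> y0; apply: sumr_ge0 => n _; rewrite mulr_ge0 ?exprn_ge0. Qed.

(** The powers of t solve the recursion of [ballot_psumSS] exactly, so the bound passes from N to
    N+1. *)
Lemma ballot_psum_le y t N k : 0 <= t -> 0 <= y -> y * (1 + t) ^+ 2 = t ->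
  ballot_psum y N k <= t ^+ k.
Proof.
move=> t0 y0 yt; elim: N k => [|N IHN] k.
  by rewrite /ballot_psum big_geq // exprn_ge0.
case: k => [|k]; first by rewrite ballot_psum0.
rewrite ballot_psumSS.
have -> : t ^+ k.+1 = y * (t ^+ k + 2 * t ^+ k.+1 + t ^+ k.+2).
  by rewrite !exprS -{1}yt; ring.
by rewrite ler_wpM2l // !lerD // ler_wpM2l.
Qed.

(** The limits satisfy the second-order recursion of t^k with the same value at 0. The bounds 0 <= L
    k <= t^k exclude the other solution, t^(-k), or k when t = 1. *)
Lemma cvg_ballot_psum y t k : 0 <= t <= 1 -> 0 <= y -> y * (1 + t) ^+ 2 = t ->
  ballot_psum y ^~ k @ \oo --> t ^+ k.
Proof.
move=> /andP[t0 t1] y0 yt.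
have cT j : cvgn (ballot_psum y ^~ j).
  apply: nondecreasing_is_cvgn.
    apply: (@nondecreasing_series _ (fun n => (ballot n j)%:R * y ^+ n) xpredT 0) => n _ _.
    by rewrite mulr_ge0 ?exprn_ge0.
  by exists (t ^+ j) => _ [N _ <-]; exact: ballot_psum_le.
pose L j := limn (ballot_psum y ^~ j).
have L0 : L 0%N = 1.
  apply: cvg_lim => //; rewrite -cvg_shiftS /=.
  by under eq_fun do rewrite ballot_psum0; exact: cvg_cst.
have Lrec j : L j.+1 = y * (L j + 2 * L j.+1 + L j.+2).
  apply: cvg_lim => //; rewrite -cvg_shiftS /=.
  under eq_fun do rewrite ballot_psumSS.
  apply: cvgMr; apply: cvgD; last exact: cT.
  by apply: cvgD; [exact: cT | apply: cvgMr; exact: cT].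
have L_ge0 j : 0 <= L j.
  by apply: limr_ge => //; near=> N; exact: ballot_psum_ge0.
have L_le j : L j <= t ^+ j.
  by apply: limr_le => //; near=> N; exact: ballot_psum_le.
suff LE : L k = t ^+ k by rewrite -LE; exact: cT.
(* Here y = 0 too, while the argument below cancels y and t. *)
have [t_eq0|t_neq0] := eqVneq t 0.
  case: k => [|k]; first by rewrite L0.
  by apply/eqP; rewrite eq_le L_le t_eq0 expr0n L_ge0.
(* The defect [D] is nonnegative, bounded, vanishes at 0 and is convex
   because [1 / y - 2 = t + 1 / t >= 2]; hence it is zero. *)
pose D j := t ^+ j - L j.
have D_ge0 j : 0 <= D j by rewrite subr_ge0.
have D_le1 j : D j <= 1.
  by apply: (@le_trans _ _ (t ^+ j)); rewrite ?gerBl // exprn_ile1.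
have D0 : D 0%N = 0 by rewrite /D L0 subrr.
have y_neq0 : y != 0 by apply: contra_neq t_neq0 => y_eq0; rewrite -yt y_eq0 mul0r.
have Drec j : t * D j.+2 = (1 + t ^+ 2) * D j.+1 - t * D j.
  have hD : D j.+1 = y * (D j + 2 * D j.+1 + D j.+2).
    have ht : t ^+ j.+1 = y * (t ^+ j + 2 * t ^+ j.+1 + t ^+ j.+2).
      by rewrite !exprS -{1}yt; ring.
    by rewrite /D {1}ht {1}Lrec; ring.
  apply: (mulfI y_neq0).
  have -> : y * (t * D j.+2) = t * (y * (D j + 2 * D j.+1 + D j.+2)) -
    y * t * D j - 2 * y * t * D j.+1 by ring.
  by rewrite -hD -{1}yt; ring.
have Dconv j : D j.+1 - D j <= D j.+2 - D j.+1.
  have t_gt0 : 0 < t by rewrite lt_neqAle eq_sym t_neq0.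
  (* Times t, the second difference of [D] equals (1 - t)^2 D (j+1). *)
  rewrite -(ler_pM2l t_gt0).
  have := Drec j; have := mulr_ge0 (sqr_ge0 (1 - t)) (D_ge0 j.+1); lra.
have Dinc j : D 1%N <= D j.+1 - D j.
  by elim: j => [|j IHj]; [rewrite D0 subr0 | exact: le_trans (Dconv j)].
have Dlin j : j%:R * D 1%N <= D j.
  elim: j => [|j IHj]; first by rewrite mul0r.
  by rewrite -natr1 mulrDl mul1r; have := Dinc j; lra.
have D1 : D 1%N = 0.
  apply/eqP; rewrite eq_le D_ge0 andbT leNgt; apply/negP => D1_gt0.
  (* An integer j > 1 / D 1 contradicts j * D 1 <= D j <= 1. *)
  have := le_trans (Dlin (Num.truncn (D 1%N)^-1).+1) (D_le1 _).
  rewrite leNgt => /negP; apply.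
  by rewrite -ltr_pdivrMr // mul1r truncnS_gt.
have Dz j : D j = 0 /\ D j.+1 = 0.
  elim: j => [//|j [IH1 IH2]]; split => //.
  by apply: (mulfI t_neq0); rewrite Drec IH1 IH2 !mulr0 subr0.
by have [/eqP] := Dz k; rewrite subr_eq0 => /eqP.
Unshelve. all: by end_near.
Qed.

End BallotSeries.

(** * Exchange of summations and passage to the limit *)

Lemma bounded_zeta_star_alt_sum (R : realType) (N r n : nat) :
  (0 < n <= N)%N -> bounded_zeta_star R N r n = alt_sum R r n.
Proof.
elim: r n => [|r IHr] n /andP[n0 nN].
  by rewrite bounded_zeta_star0 alt_sum0.
rewrite bounded_zeta_starS // alt_sumS; apply: eq_big_nat => m /andP[m0 mn].
by rewrite IHr // m0 (leq_trans _ nN).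
Qed.

Lemma zeta_star_twos (R : realType) (r n : nat) :
  (0 < n)%N -> zeta_star R (twos r) n = alt_sum R r n.
Proof. by move=> n0; rewrite zeta_star_twosE bounded_zeta_star_alt_sum // n0 leqnn. Qed.

Lemma ballot_bin_ratio (R : realType) (n k : nat) : (0 < n)%N ->
  (ballot n k)%:R = k%:R / n%:R * ('C(2 * n, n)%:R * bin_ratio R n k).
Proof.
case: n => // n _; rewrite bin_mul_ratio.
have n0 : n.+1%:R != 0 :> R by rewrite pnatr_eq0.
apply: (mulfI n0); rewrite -natrM ballotE natrM.
by move: n.+1%:R n0 => a a0; field.
Qed.

(** Finite sums are exchanged; cutting k at the same N as n loses nothing, since w(n,k) = 0 for k >
    n. The term k = 0 on the right is 0 because 1/0 = 0. *)
Lemma zeta_star_series_psum (R : realType) (r N : nat) (x : R) :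
  \sum_(1 <= n < N)
     'C(2 * n, n)%:R / (n%:R * 4 ^+ n) * zeta_star R (twos r) n * x ^+ n =
  - 2 * \sum_(0 <= k < N) (-1) ^+ k / k%:R ^+ (2 * r + 1) * ballot_psum (x / 4) N k.
Proof.
case: N => [|N]; first by rewrite !big_geq // mulr0.
rewrite [in RHS]big_ltn // addn1 expr0n invr0 mulr0 mul0r add0r.
transitivity (- 2 * \sum_(1 <= n < N.+1) \sum_(1 <= k < N.+1)
    (-1) ^+ k / k%:R ^+ (2 * r).+1 * ((ballot n k)%:R * (x / 4) ^+ n)).
  rewrite [RHS]mulr_sumr; apply: eq_big_nat => n /andP[n0 nN].
  rewrite zeta_star_twos // (alt_sum_widen R r nN).
  rewrite mulrCA -[LHS]mulrA; congr (_ * _); rewrite mulr_sumr mulr_suml.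
  apply: eq_big_nat => k /andP[k0 _].
  rewrite ballot_bin_ratio // exprMn exprVn exprS.
  have hn : n%:R != 0 :> R by rewrite pnatr_eq0 -lt0n.
  have hk : k%:R != 0 :> R by rewrite pnatr_eq0 -lt0n.
  have hkr : k%:R ^+ (2 * r) != 0 :> R by rewrite expf_neq0.
  have h4 : 4 ^+ n != 0 :> R by rewrite expf_neq0.
  move: (k%:R ^+ (2 * r)) (4 ^+ n) hkr h4 => a b a0 b0.
  by field; rewrite hk a0 b0 hn.
congr (_ * _); rewrite exchange_big_nat; apply: eq_big_nat => k /andP[k0 _].
rewrite /ballot_psum [in RHS]big_ltn // -mulr_sumr; congr (_ * _).
by case: k k0 => // k _; rewrite mul0r add0r.
Qed.

Theorem theorem2p4 (R : realType) (r : nat) (z : R) (hr : (0 < r)%N)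
    (hz0 : 0 <= z) (hz1 : z <= 1) :
  (fun N : nat => \sum_(1 <= n < N)
     'C(2 * n, n)%:R / (n%:R * 4 ^+ n) * zeta_star R (twos r) n * (1 - z) ^+ n : R)
    @ \oo --> (- 2 * Li (2 * r + 1) ((Num.sqrt z - 1) / (Num.sqrt z + 1)) : R).
Proof.
under eq_fun do rewrite zeta_star_series_psum.
apply: cvgMr.
set s := Num.sqrt z.
have s0 : 0 <= s by exact: sqrtr_ge0.
have s1 : s <= 1 by rewrite -sqrtr1 ler_wsqrtr.
have zE : z = s ^+ 2 by rewrite sqr_sqrtr.
have sn0 : s + 1 != 0 by rewrite gt_eqF //; lra.
pose t := (1 - s) / (s + 1).
have t01 : 0 <= t <= 1.
  by rewrite divr_ge0 ?ler_pdivrMr /=; lra.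
have y0 : 0 <= (1 - z) / 4 by lra.
have yt : (1 - z) / 4 * (1 + t) ^+ 2 = t by rewrite zE /t; field.
have -> : (s - 1) / (s + 1) = - t by rewrite /t -mulNr opprB.
have -> : Li (2 * r + 1) (- t) =
    limn (series (fun k => (-1) ^+ k / k%:R ^+ (2 * r + 1) * t ^+ k)).
  rewrite /Li; congr (limn _); apply/funext => -[|N]; rewrite /series /=.
    by rewrite !big_geq.
  rewrite [in RHS]big_ltn // addn1 [in RHS]expr0n invr0 mulr0 mul0r add0r.
  by apply: eq_bigr => k _; rewrite -mulN1r exprMn mulrAC.
(* Domination holds because the partial sums lie in [0, 1] and 2r + 1 >= 2; at k = 0 both inverses
   are 0. *)
apply: (tannery (M := fun k => (k%:R ^+ 2)^-1)); last first.
- by move=> k; apply: cvgMr; exact: cvg_ballot_psum.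
- exact: cvg_series_inv_sqr.
move=> N k; rewrite !normrM normrX normrN normr1 expr1n mul1r normfV.
have T0 := ballot_psum_ge0 N k y0.
have T1 : ballot_psum ((1 - z) / 4) N k <= 1.
  case/andP: t01 => t0 t1.
  by apply: le_trans (ballot_psum_le N k t0 y0 yt) _; rewrite exprn_ile1.
rewrite (ger0_norm T0) ger0_norm ?exprn_ge0 //.
have inv0 p : 0 <= (k%:R ^+ p)^-1 :> R by rewrite invr_ge0 exprn_ge0.
apply: (@le_trans _ _ ((k%:R ^+ (2 * r + 1))^-1)).
  by rewrite ler_piMr.
case: k {T0 T1} inv0 => [|k] inv0.
  by rewrite addn1 !expr0n.
rewrite lef_pV2 ?posrE ?exprn_gt0 ?ltr0n // ler_weXn2l ?ler1n //; lia.
Qed.
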